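(* Let $p=p(n)$ satisfy $p\le 2^{-a\sqrt n\log n}$ for some constant $a>0$ and all sufficiently large $n$, and $p\ge\omega(n)/2^n$ for some function $\omega(n)\to\infty$. Let $t=t(n)$ be a positive integer with $t=o(\sqrt n)$. Then there exists a constant $\varepsilon>0$ such that, with probability tending to $1$ as $n\to\infty$, the largest $t$-intersecting family contained in $\mathcal P(n,p)$ has size at least $(\frac12+\varepsilon)2^np$.
   Context: A family $\mathcal A\subseteq\mathcal P(n)$ is $t$-intersecting if $|A\cap B|\ge t$ for all $A,B\in\mathcal A$. $\mathcal P(n,p)$ is the random subfamily of $\mathcal P(n)$ obtained by including each subset of $[n]$ independently with probability $p$. Logarithms are base 2. *)

(* Defs.v *)
From HB Require Import structures.
From mathcomp Require Import all_boot all_order all_algebra.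
From mathcomp Require Import all_classical all_reals all_analysis.

Set Implicit Arguments.
Unset Strict Implicit.
Unset Printing Implicit Defensive.

Import Order.TTheory GRing.Theory Num.Theory.
Import numFieldNormedType.Exports.

Local Open Scope ring_scope.

(* The ground set [n] is 'I_n, so P(n) is the type {set 'I_n} and families
   are elements of {set {set 'I_n}}. The case A = B is included. *)
Definition t_intersecting (n t : nat) (F : {set {set 'I_n}}) : bool :=
  [forall A in F, forall B in F, (t <= #|A :&: B|)%N].

(* The maximum is over a nonempty collection: set0 is t-intersecting. *)
Definition max_t_intersecting (n t : nat) (F : {set {set 'I_n}}) : nat :=
  \max_(G : {set {set 'I_n}} | (G \subset F) && t_intersecting t G) #|G|.

(* The law of P(n,p): the factors are the independent choices, one for each
   A, of including A in the family. *)
Definition random_family_pmf (R : realType) (n : nat) (p : R)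
    (F : {set {set 'I_n}}) : R :=
  \prod_(A : {set 'I_n}) (if A \in F then p else 1 - p).

Definition random_family_prob (R : realType) (n : nat) (p : R)
    (E : pred {set {set 'I_n}}) : R :=
  \sum_(F : {set {set 'I_n}} | E F) random_family_pmf p F.

Lemma random_family_probT (R : realType) (n : nat) (p : R) :
  random_family_prob p (fun _ : {set {set 'I_n}} => true) = 1.
Proof.
rewrite /random_family_prob /random_family_pmf.
rewrite -(bigA_distr _ _ (fun=> p) (fun=> 1 - p)) big1 // => A _.
by rewrite /= addrC subrK.
Qed.

Definition log2 (R : realType) (x : R) : R := ln x / ln 2.

(* Main.v *)
(* Put m = c sqrt n with c small and let S be the family of sets of size at
   least n/2 - m. Pairing each set with its complement, and comparing the
   central window of binomial coefficients with the window of width sqrt n that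
   Chebyshev's inequality controls, |S| >= (1/2 + 3 eps) 2^n. If B is in S, then
   any A in S with |A :&: B| < t nearly equals the complement of B, up to at
   most 2m + t omitted and t added elements, so there are at most
   (n+1)^(2(m+t)) = n^O((c + o(1)) sqrt n) such A, which is o(1/p). Hence the
   random family has (1/2 + 3 eps + o(1)) 2^n p members in S, and only
   o(2^n p) of them lie in a pair that is not t-intersecting; delete those. *)
Require Import Defs.
From HB Require Import structures.
From mathcomp Require Import all_boot all_order all_algebra.
From mathcomp Require Import all_classical all_reals all_analysis.
From mathcomp Require Import zify ring lra.

Set Implicit Arguments.
Unset Strict Implicit.
Unset Printing Implicit Defensive.

Import Order.TTheory GRing.Theory Num.Theory.
Import numFieldNormedType.Exports.

(** * Binomial sums: second moment and mass of a central window *)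

Lemma sum_binS (n : nat) (f : nat -> nat) :
  \sum_(k < n.+2) 'C(n.+1, k) * f k = \sum_(k < n.+1) 'C(n, k) * (f k + f k.+1).
Proof.
rewrite big_ord_recl /= bin0 mul1n.
under eq_bigr => i _ do rewrite /bump /= add1n binS mulnDl.
rewrite big_split /= addnA.
have -> : f 0 + \sum_(i < n.+1) 'C(n, i.+1) * f i.+1 = \sum_(i < n.+1) 'C(n, i) * f i.
  transitivity (\sum_(i < n.+2) 'C(n, i) * f i).
    by rewrite [RHS]big_ord_recl /= bin0 mul1n.
  by rewrite big_ord_recr /= bin_small // mul0n addn0.
by rewrite -big_split /=; apply: eq_bigr => i _; rewrite mulnDr.
Qed.

(** The variance of a symmetric binomial law. Of the two truncated differences one is zero, so their
    sum is [|n - 2k|]. Pascal's rule turns the induction step into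
    [(x - 1)^2 + (x + 1)^2 = 2x^2 + 2]. *)
Lemma sum_bin_dev_sqr (n : nat) :
  \sum_(k < n.+1) 'C(n, k) * ((n - k.*2) + (k.*2 - n)) ^ 2 = n * 2 ^ n.
Proof.
elim: n => [|n IHn]; first by rewrite big_ord1.
rewrite (sum_binS _ (fun k => ((n.+1 - k.*2) + (k.*2 - n.+1)) ^ 2)).
(* The powers of 1 put the constant part in the shape of the binomial theorem, which sums it to
   [2 ^ n]. *)
transitivity (\sum_(k < n.+1)
   (2 * ('C(n, k) * ((n - k.*2) + (k.*2 - n)) ^ 2)
    + 2 * ('C(n, k) * (1 ^ (n - k) * 1 ^ k)))).
  apply: eq_bigr => k _; rewrite !exp1n !muln1 mulnCA [2 * 'C(n, k)]mulnC -mulnDr.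
  congr (_ * _); rewrite doubleS; move: (k.*2) => d.
  case: (ssrnat.ltngtP d n) => [lt_dn|lt_nd|->].
  - have [e ->] : exists e, n = d + e.+1 by exists (n - d).-1; lia.
    rewrite (_ : (d + e.+1).+1 - d + _ = e.+2); last lia.
    rewrite (_ : (d + e.+1).+1 - d.+2 + _ = e); last lia.
    rewrite (_ : d + e.+1 - d + _ = e.+1); last lia.
    by nia.
  - have [e ->] : exists e, d = n + e.+1 by exists (d - n).-1; lia.
    rewrite (_ : n.+1 - (n + e.+1) + _ = e); last lia.
    rewrite (_ : n.+1 - (n + e.+1).+2 + _ = e.+2); last lia.
    rewrite (_ : n - (n + e.+1) + _ = e.+1); last lia.
    by nia.
  - by rewrite !subSS subSnn subnn (eqP (leqnSn n : n - n.+1 == 0)) addn0 add0n.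
by rewrite big_split /= -!big_distrr /= IHn -(expnDn 1 1) (expnS 2)
  -mulnDr addnC -mulSn mulnCA.
Qed.

Lemma sum_bin_rev (n : nat) (f : nat -> nat) :
  \sum_(k < n.+1) 'C(n, k) * f (n - k) = \sum_(k < n.+1) 'C(n, k) * f k.
Proof.
rewrite (reindex_inj rev_ord_inj) /=; apply: eq_bigr => k _.
have lekn : k <= n by rewrite -ltnS.
by rewrite subSS subKn // bin_sub.
Qed.

Lemma sum_bin (n : nat) : \sum_(k < n.+1) 'C(n, k) = 2 ^ n.
Proof. by rewrite (expnDn 1 1 n); apply: eq_bigr => k _; rewrite !exp1n !muln1. Qed.

(** Chebyshev's inequality from the second moment above. *)
Lemma sum_bin_far (n d : nat) :
  d ^ 2 * \sum_(k < n.+1) 'C(n, k) * (d <= (n - k.*2) + (k.*2 - n)) <= n * 2 ^ n.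
Proof.
rewrite -sum_bin_dev_sqr big_distrr /=; apply: leq_sum => k _.
case: (leqP d) => [le_d|_]; last by rewrite !muln0.
by rewrite muln1 mulnC leq_mul2l leq_exp2r // le_d orbT.
Qed.

Lemma bin_lower_half (n k : nat) : k.*2 < n -> 'C(n, k) <= 'C(n, k.+1).
Proof.
move=> lt_kn; have := mul_bin_left n k.
have : 'C(n, k) * k.+1 <= 'C(n, k) * (n - k) by rewrite leq_mul2l; apply/orP; right; lia.
move=> h1 h2; rewrite -(leq_pmul2l (ltn0Sn k)) h2 mulnC; lia.
Qed.

(** Cut the range into [K] blocks of length [m]; by monotonicity the first block is the heaviest. *)
Lemma sum_nonincr_le (g : nat -> nat) (K m : nat) :
  (forall j, g j.+1 <= g j) -> \sum_(j < K * m) g j <= K * \sum_(j < m) g j.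
Proof.
move=> g_dec; have g_le i j : g (i + j) <= g j.
  by elim: i => // i IHi; apply: leq_trans (g_dec _) IHi.
elim: K => [|K IHK]; first by rewrite mul0n big_ord0.
rewrite !mulSn big_split_ord /= leq_add2l.
by apply: leq_trans IHK; apply: leq_sum => j _; apply: g_le.
Qed.

(* Zero past [j = n./2], where the truncated subtraction would repeat 'C(n, 0). *)
Definition lower_coef (n j : nat) : nat := if j <= n./2 then 'C(n, n./2 - j) else 0.

Lemma lower_coef_nonincr (n j : nat) : lower_coef n j.+1 <= lower_coef n j.
Proof.
rewrite /lower_coef; case: (ltnP j n./2) => // lt_j; rewrite (ltnW lt_j).
have -> : n./2 - j = (n./2 - j.+1).+1 by lia.
by apply: bin_lower_half; lia.
Qed.

Lemma sum_lower_coef (n M : nat) :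
  \sum_(k < n.+1) 'C(n, k) * ((k <= n./2) && (n./2 < k + M)) = \sum_(j < M) lower_coef n j.
Proof.
set h := n./2; have le_hn : h.+1 <= n.+1 by rewrite /h; lia.
transitivity (\sum_(k < h.+1) 'C(n, k) * (h < k + M)).
  rewrite (big_ord_widen _ (fun k => 'C(n, k) * (h < k + M)) le_hn) [RHS]big_mkcond /=.
  by apply: eq_bigr => k _; rewrite ltnS; case: (k <= h); rewrite ?muln0.
rewrite (reindex_inj rev_ord_inj) /=.
transitivity (\sum_(j < h.+1 | j < M) lower_coef n j).
  rewrite [RHS]big_mkcond; apply: eq_bigr => j _; have := ltn_ord j; rewrite ltnS => le_jh.
  rewrite /lower_coef -/h le_jh subSS.
  by rewrite (_ : (h < h - j + M) = (j < M)); [case: ifP; rewrite ?muln1 ?muln0 | lia].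
(* When [M] exceeds [h.+1], the surplus indices only meet the zero default of [lower_coef]. *)
case: (leqP M h.+1) => [le_Mh|/ltnW le_hM].
  by rewrite (big_ord_widen _ (lower_coef n) le_Mh).
rewrite [RHS](bigID (fun j : 'I_M => j < h.+1)) /= [X in _ = _ + X]big1 => [|j].
  rewrite addn0 -(big_ord_widen _ (lower_coef n) le_hM).
  by apply: eq_bigl => j; apply: leq_trans (ltn_ord j) le_hM.
by rewrite -leqNgt /lower_coef -/h => lt_hj; rewrite leqNgt lt_hj.
Qed.

(** The reflection [k -> n - k] maps the upper half of the window into the lower one, whence the
    factor 2. *)
Lemma sum_bin_near_le (n M : nat) :
  \sum_(k < n.+1) 'C(n, k) * ((n - k.*2) + (k.*2 - n) < M.*2)
    <= 2 * \sum_(j < M) lower_coef n j.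
Proof.
rewrite -sum_lower_coef mul2n -[X in _ <= X]addnn.
rewrite -{2}(sum_bin_rev _ (fun k => (k <= n./2) && (n./2 < k + M) : nat)) -big_split /=.
apply: leq_sum => k _; rewrite -mulnDr leq_mul2l; apply/orP; right.
have := ltn_ord k; lia.
Qed.

Lemma sum_bin_near_ge (n m : nat) :
  \sum_(j < m) lower_coef n j
    <= \sum_(k < n.+1) 'C(n, k) * ((n - k.*2) + (k.*2 - n) <= m.*2).
Proof.
rewrite -sum_lower_coef; apply: leq_sum => k _; rewrite leq_mul2l; apply/orP; right.
have := ltn_ord k; lia.
Qed.

(** Chebyshev leaves at least 3/4 of the mass within distance [2Km]; the window that is [K] times
    narrower keeps at least a fraction [1/(2K)] of it, by reflection and monotonicity of the
    coefficients. *)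
Lemma sum_bin_central (n m K : nat) :
  n < (K * m) ^ 2 ->
  3 * 2 ^ n <= 8 * K * \sum_(k < n.+1) 'C(n, k) * ((n - k.*2) + (k.*2 - n) <= m.*2).
Proof.
move=> lt_n; set W := (\sum_(k < n.+1) _).
have near_far : \sum_(k < n.+1) 'C(n, k) * ((n - k.*2) + (k.*2 - n) < (K * m).*2)
   + \sum_(k < n.+1) 'C(n, k) * ((K * m).*2 <= (n - k.*2) + (k.*2 - n)) = 2 ^ n.
  rewrite -big_split /= -sum_bin; apply: eq_bigr => k _.
  by rewrite -mulnDr; case: leqP; rewrite ?addn0 ?add0n muln1.
have := leq_trans (sum_bin_near_le n (K * m))
  (leq_mul (leqnn 2) (sum_nonincr_le K m (lower_coef_nonincr n))).
have := sum_bin_near_ge n m; rewrite -/W.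
have := sum_bin_far n (K * m).*2.
move: near_far; set N := (X in X + _ = _); set F := (X in _ + X = _).
set L := (\sum_(j < m) _); move=> NF far LW NL.
(* The squared distance [(2Km)^2] exceeds [4n]. For [n = 0] one cannot cancel [n], but then
   Chebyshev gives [F = 0]. *)
have F4 : 4 * F <= 2 ^ n.
  have [n0 | n_gt0] := posnP n; last first.
    rewrite -(leq_pmul2l n_gt0); apply: leq_trans far.
    rewrite mulnA leq_mul2r; apply/orP; right; rewrite -mul2n expnMn; nia.
  have d_gt0 : 0 < (K * m) ^ 2 by apply: leq_ltn_trans lt_n.
  have : (K * m).*2 ^ 2 * F <= 0 by move: far; rewrite [X in X * 2 ^ n]n0 mul0n.
  rewrite -mul2n expnMn; nia.
have : 3 * 2 ^ n <= 4 * N by lia.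
by nia.
Qed.

(** * Large sets, conflicting pairs and the deletion argument *)

Lemma sum_card_set (n : nat) (f : nat -> nat) :
  \sum_(A : {set 'I_n}) f #|A| = \sum_(k < n.+1) 'C(n, k) * f k.
Proof.
have le_card (A : {set 'I_n}) : #|A| < n.+1 by rewrite ltnS -[X in _ <= X]card_ord max_card.
rewrite (partition_big (fun A : {set 'I_n} => Ordinal (le_card A)) xpredT) //=.
apply: eq_bigr => k _.
rewrite (eq_bigr (fun=> f k)) => [|A /eqP <-] //.
rewrite sum_nat_const; congr (_ * _).
have := card_draws 'I_n k; rewrite card_ord => <-.
by rewrite -!sum1_card; apply: eq_bigl => A; rewrite [RHS]inE.
Qed.

(** The bound [#|A| >= n/2 - m] is doubled to avoid rounding. *)
Definition large_sets (n m : nat) : {set {set 'I_n}} :=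
  [set A : {set 'I_n} | n <= #|A|.*2 + m.*2].

(** Among the sizes [k] and [n - k] at least one is large, and both are exactly when
    [|n - 2k| <= 2m]. *)
Lemma card_large_sets (n m : nat) :
  (#|large_sets n m|).*2
    = 2 ^ n + \sum_(k < n.+1) 'C(n, k) * ((n - k.*2) + (k.*2 - n) <= m.*2).
Proof.
have -> : #|large_sets n m| = \sum_(k < n.+1) 'C(n, k) * (n <= k.*2 + m.*2).
  rewrite -(sum_card_set n (fun k => n <= k.*2 + m.*2)) -sum1_card big_mkcond /=.
  by apply: eq_bigr => A _; rewrite inE; case: leqP.
rewrite -addnn -{2}(sum_bin_rev n (fun k => n <= k.*2 + m.*2)) -sum_bin -!big_split /=.
apply: eq_bigr => k _; rewrite -mulnDr -{2}(muln1 'C(n, k)) -mulnDr; congr (_ * _).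
have := ltn_ord k; lia.
Qed.

(** List the elements of the set and pad with [None] to length [k]; the tuple determines the set. *)
Lemma card_small_sets (n k : nat) :
  #|[set C : {set 'I_n} | #|C| <= k]| <= n.+1 ^ k.
Proof.
pose f (s : k.-tuple (option 'I_n)) := [set x : 'I_n | Some x \in s].
have sub : [set C : {set 'I_n} | #|C| <= k] \subset f @: [set: k.-tuple (option 'I_n)].
  apply/fintype.subsetP => C; rewrite inE => le_Ck.
  pose s := [seq Some x | x <- enum C] ++ nseq (k - #|C|) None.
  have sz : size s == k by rewrite size_cat size_map size_nseq -cardE subnKC.
  apply/imsetP; exists (Tuple sz) => //; apply/setP => x.
  by rewrite inE /= mem_cat mem_nseq andbF orbF mem_map ?mem_enum // => ? ? [].
apply: leq_trans (subset_leq_card sub) _; apply: leq_trans (leq_imset_card _ _) _.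
by rewrite cardsT card_tuple card_option card_ord.
Qed.

(** The diagonal is left out so that the events [A \in F] and [B \in F] are independent. *)
Definition conflicts (n m t : nat) (B : {set 'I_n}) : {set {set 'I_n}} :=
  [set A in large_sets n m | (A != B) && (#|A :&: B| < t)].

(* [A] is recovered from [A :&: B] and the complement of [A :|: B], both of
   which are small. *)
Lemma card_conflicts (n m t : nat) (B : {set 'I_n}) :
  B \in large_sets n m -> #|conflicts m t B| <= n.+1 ^ (2 * (m + t)).
Proof.
rewrite inE => largeB.
pose f (A : {set 'I_n}) := (A :&: B, ~: (A :|: B)).
have f_inj : injective f.
  move=> A A' [] /setP eqI /setP eqC; apply/setP => x.
  move: (eqI x) (eqC x); rewrite !inE.
  by case: (x \in A); case: (x \in A'); case: (x \in B).
rewrite -(card_imset _ f_inj).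
(* Two large sets have sizes adding up to at least [n - 2m], so at most [2m + #|A :&: B|] points lie
   outside their union. The exponents [t] and [m.*2 + t] add up to [2 * (m + t)]. *)
have sub : f @: conflicts m t B \subset
    finset.setX [set C : {set 'I_n} | #|C| <= t] [set C : {set 'I_n} | #|C| <= m.*2 + t].
  apply/fintype.subsetP => _ /imsetP[A + ->]; rewrite !inE /= => /and3P[largeA _ ltI].
  rewrite (ltnW ltI) /=; have := cardsUI A B; have := cardsC (A :|: B).
  rewrite card_ord; move: largeA largeB ltI;
    move: #|A| #|B| #|A :&: B| #|A :|: B| #|~: (A :|: B)| => a b c d e. lia.
apply: leq_trans (subset_leq_card sub) _; rewrite cardsX.
apply: leq_trans (leq_mul (card_small_sets _ _) (card_small_sets _ _)) _.
by rewrite -expnD leq_pexp2l //; lia.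
Qed.

Lemma card_sub_conflicts_le_max (n m t : nat) (F : {set {set 'I_n}}) :
  (t + m).*2 <= n ->
  #|F :&: large_sets n m|
    <= max_t_intersecting t F
       + \sum_(B in large_sets n m) \sum_(A in conflicts m t B) (A \in F) * (B \in F).
Proof.
move=> le_tm; set S := large_sets n m.
(* Each conflicting pair loses its second member. *)
pose bad := [set B in F :&: S | [exists A in conflicts m t B, A \in F]].
have good : #|(F :&: S) :\: bad| <= max_t_intersecting t F.
  apply: (@leq_bigmax_cond _ _ (fun G : {set {set 'I_n}} => #|G|)).
  apply/andP; split.
    by apply/fintype.subsetP => A; rewrite !inE => /andP[_ /andP[]].
  apply/forall_inP => A goodA; apply/forall_inP => B goodB.
  move: goodA goodB; rewrite !inE => /andP[_ /andP[FA largeA]].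
  move=> /andP[+ /andP[FB largeB]]; rewrite FB largeB /= => nbad.
  (* On the diagonal, [le_tm] makes a large set have at least [t] elements. *)
  have [<-|neq] := eqVneq A B.
    by rewrite finset.setIid; move: largeA le_tm; move: #|A| => a; lia.
  rewrite leqNgt; apply: contra nbad => ltI.
  by apply/exists_inP; exists A => //; rewrite !inE largeA neq.
rewrite -(cardsID bad (F :&: S)) addnC; apply: leq_add => //.
apply: (@leq_trans #|bad|); first by rewrite subset_leq_card // finset.subsetIr.
rewrite -sum1_card big_mkcond [X in _ <= X]big_mkcond; apply: leq_sum => B _.
rewrite 2!inE; have [SB|_] := boolP (B \in S); last by rewrite andbF.
rewrite andbT; have [FB /=|//] := boolP (B \in F).
case: ifP => // /exists_inP[A confA FA].
by rewrite (bigD1 A) //= FA.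
Qed.

Lemma card_family_le (n : nat) (S : {set {set 'I_n}}) : #|S| <= 2 ^ n.
Proof.
rewrite -[X in _ ^ X]card_ord -cardsT -card_powerset powersetT.
exact/subset_leq_card/finset.subsetT.
Qed.

(** * Moments of the random family *)

Local Open Scope classical_set_scope.
Local Open Scope ring_scope.

Definition family_expect (R : realType) (n : nat) (p : R)
    (X : {set {set 'I_n}} -> R) : R :=
  \sum_(F : {set {set 'I_n}}) random_family_pmf p F * X F.

(** Independence of the choices, as distributivity: expanding the product of two-term sums yields
    one term per family. *)
Lemma family_expect_prod (R : realType) (n : nat) (p : R)
    (g : {set 'I_n} -> bool -> R) :
  family_expect p (fun F => \prod_A g A (A \in F))
    = \prod_A (p * g A true + (1 - p) * g A false).
Proof.
rewrite bigA_distr; apply: eq_bigr => F _.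
rewrite -big_split /=; apply: eq_bigr => A _.
by case: (A \in F).
Qed.

(** Take the product formula with factors equal to 1 away from [A] and [B]; each such factor
    contributes [p + (1 - p) = 1]. *)
Lemma family_expect_pair (R : realType) (n : nat) (p : R) (A B : {set 'I_n})
    (g h : bool -> R) : A != B ->
  family_expect p (fun F => g (A \in F) * h (B \in F))
    = (p * g true + (1 - p) * g false) * (p * h true + (1 - p) * h false).
Proof.
move=> neq.
pose f (C : {set 'I_n}) b := if C == A then g b else if C == B then h b else 1.
have -> : (fun F : {set {set 'I_n}} => g (A \in F) * h (B \in F))
    = (fun F => \prod_C f C (C \in F)).
  apply: funext => F; rewrite (bigD1 A) //= (bigD1 B) 1?eq_sym //=.
  rewrite big1 => [|C /andP[/negbTE CA /negbTE CB]]; last by rewrite /f CA CB.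
  by rewrite /f !eqxx eq_sym (negbTE neq) mulr1.
rewrite family_expect_prod (bigD1 A) //= (bigD1 B) 1?eq_sym //=.
rewrite big1 => [|C /andP[/negbTE CA /negbTE CB]]; last by rewrite /f CA CB; ring.
by rewrite /f !eqxx eq_sym (negbTE neq) mulr1.
Qed.

Lemma family_expect_one (R : realType) (n : nat) (p : R) (A : {set 'I_n})
    (g : bool -> R) :
  family_expect p (fun F => g (A \in F)) = p * g true + (1 - p) * g false.
Proof.
pose f (C : {set 'I_n}) b := if C == A then g b else 1.
have -> : (fun F : {set {set 'I_n}} => g (A \in F)) = (fun F => \prod_C f C (C \in F)).
  apply: funext => F; rewrite (bigD1 A) //=.
  rewrite big1 => [|C /negbTE CA]; last by rewrite /f CA.
  by rewrite /f !eqxx mulr1.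
rewrite family_expect_prod (bigD1 A) //=.
rewrite big1 => [|C /negbTE CA]; last by rewrite /f CA; ring.
by rewrite /f !eqxx mulr1.
Qed.

Lemma family_expect_sum (R : realType) (n : nat) (p : R) (I : finType) (P : pred I)
    (X : I -> {set {set 'I_n}} -> R) :
  family_expect p (fun F => \sum_(i | P i) X i F)
    = \sum_(i | P i) family_expect p (X i).
Proof.
rewrite /family_expect exchange_big /=.
by apply: eq_bigr => F _; rewrite big_distrr.
Qed.

Lemma family_variance (R : realType) (n : nat) (p : R) (S : {set {set 'I_n}}) :
  family_expect p (fun F => (#|F :&: S|%:R - p * #|S|%:R) ^+ 2)
    = p * (1 - p) * #|S|%:R.
Proof.
have -> : (fun F : {set {set 'I_n}} => (#|F :&: S|%:R - p * #|S|%:R) ^+ 2)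
    = (fun F => \sum_(A in S) \sum_(B in S) ((A \in F)%:R - p) * ((B \in F)%:R - p)).
  apply: funext => F.
  have -> : #|F :&: S|%:R - p * #|S|%:R = \sum_(A in S) ((A \in F)%:R - p).
    rewrite sumrB sumr_const mulr_natr; congr (_ - _).
    rewrite -sum1_card natr_sum big_mkcond [RHS]big_mkcond; apply: eq_bigr => A _.
    by rewrite inE; case: (A \in F); case: (A \in S).
  by rewrite expr2 big_distrl; apply: eq_bigr => A _; rewrite big_distrr.
rewrite family_expect_sum mulr_natr -sumr_const; apply: eq_bigr => A SA.
(* Centred indicators of distinct sets are uncorrelated, so only the diagonal term [p * (1 - p)]
   survives. *)
rewrite family_expect_sum (bigD1 A) //= [X in _ + X]big1 => [|B /andP[_ neq]].
  rewrite (family_expect_one p A (fun b : bool => (b%:R - p) * (b%:R - p))) /=; ring.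
rewrite (family_expect_pair p (fun b : bool => b%:R - p)
  (fun b : bool => b%:R - p)) 1?eq_sym //=.
by ring.
Qed.

(** Each pair of distinct sets is present with probability [p ^+ 2]; there are at most [2 ^ n]
    choices of [B], and [card_conflicts] bounds those of [A]. *)
Lemma family_expect_conflicts (R : realType) (n m t : nat) (p : R) :
  family_expect p (fun F : {set {set 'I_n}} =>
      (\sum_(B in large_sets n m) \sum_(A in conflicts m t B) (A \in F) * (B \in F))%N%:R)
    <= p ^+ 2 * 2 ^+ n * (n.+1 ^ (2 * (m + t)))%:R.
Proof.
have -> : (fun F : {set {set 'I_n}} =>
      (\sum_(B in large_sets n m) \sum_(A in conflicts m t B) (A \in F) * (B \in F))%N%:R)
    = (fun F => \sum_(B in large_sets n m) \sum_(A in conflicts m t B)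
          (A \in F)%:R * (B \in F)%:R :> R).
  apply: funext => F; rewrite natr_sum; apply: eq_bigr => B _.
  by rewrite natr_sum; apply: eq_bigr => A _; rewrite natrM.
rewrite family_expect_sum.
apply: (@le_trans _ _ (\sum_(B in large_sets n m) p ^+ 2 * (n.+1 ^ (2 * (m + t)))%:R)).
  apply: ler_sum => B SB; rewrite family_expect_sum.
  rewrite (eq_bigr (fun=> p ^+ 2)) => [|A]; last first.
    rewrite inE => /and3P[_ neq _].
    rewrite (family_expect_pair p (fun b : bool => b%:R) (fun b : bool => b%:R)) //=.
    by ring.
  rewrite sumr_const -[leLHS]mulr_natr ler_wpM2l ?sqr_ge0 // ler_nat.
  exact: card_conflicts.
rewrite sumr_const -[leLHS]mulr_natr mulrAC ler_wpM2r // ler_wpM2l ?sqr_ge0 //.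
rewrite -natrX ler_nat; exact: card_family_le.
Qed.

(* Chebyshev's inequality for the number of large sets, and Markov's for the
   number of conflicting pairs, in a single moment bound. *)
Lemma random_family_prob_ge (R : realType) (n m t K : nat) (p eps : R) :
  eps = (16 * K%:R)^-1 -> 0 < p <= 1 -> (0 < K)%N ->
  ((t + m).*2 <= n)%N -> (n < (K * m) ^ 2)%N ->
  1 - (eps ^+ 2 * (2 ^+ n * p))^-1 - p * (n.+1 ^ (2 * (m + t)))%:R / eps
  <= random_family_prob p (fun F : {set {set 'I_n}} =>
       (2^-1 + eps) * 2 ^+ n * p <= (max_t_intersecting t F)%:R).
Proof.
move=> def_eps /andP[p0 p1] K0 le_tm lt_n.
have K0' : (0 : R) < K%:R by rewrite ltr0n.
have eps0 : 0 < eps by rewrite def_eps invr_gt0 mulr_gt0.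
have eps_K : eps * (16 * K%:R) = 1 by rewrite def_eps mulVf // mulf_neq0 ?gt_eqF.
set S := large_sets n m.
(* Half of the central mass, a fraction at least [3/(8K)], is added to [1/2]; this is [3 * eps] for
   [eps = 1/(16K)]. *)
have S_large : (2^-1 + 3 * eps) * 2 ^+ n <= #|S|%:R.
  have := sum_bin_central lt_n; have := card_large_sets n m; rewrite -/S.
  set W := (\sum_(k < n.+1) _)%N => cardS.
  have {}cardS : 2 * #|S|%:R = 2 ^+ n + W%:R :> R.
    by rewrite -natrX -natrD -cardS -mul2n natrM.
  rewrite -(ler_nat R) !natrM natrX => leW.
  have : eps * (3 * 2 ^+ n) <= eps * (8 * K%:R * W%:R) by rewrite ler_pM2l.
  have -> : eps * (8 * K%:R * W%:R) = eps * (16 * K%:R) * W%:R / 2 by field.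
  rewrite eps_K; lra.
set q : R := 2 ^+ n * p; have q0 : 0 < q by rewrite mulr_gt0 // exprn_gt0.
pose X (F : {set {set 'I_n}}) : R := (#|F :&: S|%:R - p * #|S|%:R) ^+ 2.
pose Y (F : {set {set 'I_n}}) : R :=
  (\sum_(B in S) \sum_(A in conflicts m t B) (A \in F) * (B \in F))%N%:R.
have pmf_ge0 (F : {set {set 'I_n}}) : 0 <= random_family_pmf p F.
  by apply: prodr_ge0 => A _; case: ifP => _; [apply: ltW | rewrite subr_ge0].
pose E (F : {set {set 'I_n}}) := (2^-1 + eps) * 2 ^+ n * p <= (max_t_intersecting t F)%:R.
rewrite -[leRHS]/(\sum_(F | E F) random_family_pmf p F).
have total := random_family_probT n p; rewrite /random_family_prob in total.
rewrite (bigID E) /= in total.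
(* The mean of [#|F :&: S|] exceeds the target by at least [2 * eps * q]. If [E F] fails, then
   either the conflicts number at least [eps * q], or [#|F :&: S|] is more than [eps * q] below its
   mean. *)
have bad_le : \sum_(F | ~~ E F) random_family_pmf p F
    <= family_expect p X * (eps * q)^-2 + family_expect p Y / (eps * q).
  rewrite !big_distrl -big_split /= big_mkcond; apply: ler_sum => F _.
  rewrite -(mulrA _ (X F)) -(mulrA _ (Y F)) -mulrDr; have X0 : 0 <= X F by apply: sqr_ge0.
  have Y0 : 0 <= Y F by apply: ler0n.
  have l0 : 0 < eps * q by rewrite mulr_gt0.
  have X1 : 0 <= X F * (eps * q) ^- 2 by rewrite mulr_ge0 // invr_ge0 exprn_ge0 // ltW.
  have Y1 : 0 <= Y F / (eps * q) by rewrite mulr_ge0 // invr_ge0 ltW.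
  case: ifP => [nE|_]; last by apply: mulr_ge0 => //; apply: addr_ge0.
  rewrite ler_peMr //.
  have := card_sub_conflicts_le_max F le_tm; rewrite -(ler_nat R) natrD -/S -/(Y F) => leM.
  move: nE; rewrite /E -ltNge -mulrA -/q => ltM.
  have mu : (2^-1 + 3 * eps) * q <= p * #|S|%:R.
    by rewrite /q mulrA [leRHS]mulrC ler_pM2r.
  have [leY|ltY] := lerP (eps * q) (Y F).
    have : 1 <= Y F / (eps * q) by rewrite ler_pdivlMr // mul1r.
    by lra.
  have : 1 <= X F * (eps * q) ^- 2.
    rewrite ler_pdivlMr ?exprn_gt0 // mul1r /X -[leRHS]sqrrN ler_sqr ?nnegrE; lra.
  by lra.
have EX : family_expect p X * (eps * q)^-2 <= (eps ^+ 2 * q)^-1.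
  rewrite ler_pdivrMr ?exprn_gt0 ?mulr_gt0 //.
  have -> : (eps ^+ 2 * q)^-1 * (eps * q) ^+ 2 = q by field; rewrite !gt_eqF.
  have leS : #|S|%:R <= 2 ^+ n :> R by rewrite -natrX ler_nat card_family_le.
  rewrite /X family_variance /q -subr_ge0.
  have -> : 2 ^+ n * p - p * (1 - p) * #|S|%:R
      = p * (2 ^+ n - #|S|%:R) + p * (p * #|S|%:R) by ring.
  have p0' := ltW p0.
  by rewrite addr_ge0 ?mulr_ge0 ?subr_ge0.
have EY : family_expect p Y / (eps * q) <= p * (n.+1 ^ (2 * (m + t)))%:R / eps.
  rewrite invfM mulrA mulrAC ler_wpM2r ?invr_ge0 ?(ltW eps0) //.
  rewrite ler_pdivrMr //; apply: le_trans (family_expect_conflicts _ _ _ _) _.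
  by rewrite le_eqVlt; apply/orP; left; apply/eqP; rewrite /q; ring.
by lra.
Qed.

(** * Asymptotic estimates and choice of parameters *)

Lemma random_family_prob_le1 (R : realType) (n : nat) (p : R)
    (E : pred {set {set 'I_n}}) :
  0 <= p <= 1 -> random_family_prob p E <= 1.
Proof.
move=> /andP[p0 p1]; rewrite -(random_family_probT n p) /random_family_prob.
rewrite big_mkcond; apply: ler_sum => F _; case: ifP => // _.
by apply: prodr_ge0 => A _; case: ifP => _; rewrite ?subr_ge0.
Qed.

Lemma near_sqrt_ge (R : realType) (M : R) :
  \forall n \near \oo, M <= Num.sqrt (n%:R : R).
Proof.
near=> n; have : M ^+ 2 <= n%:R by near: n; exact: nbhs_infty_ger.
move=> /ler_wsqrtr; rewrite sqrtr_sqr; exact: le_trans (ler_norm M).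
Unshelve. all: by end_near. Qed.

(** With [x = sqrt n], the hypothesis on [p] reads [p <= n^(-ax)], while [n + 1 <= n^2] gives
    [(n + 1)^(2s) <= n^(4s) <= n^(ax/2)]. The product is at most [n^(-ax/2) <= exp(-ax/2)], and
    [1 + y <= exp y] finishes. *)
Lemma sparse_conflicts_le (R : realType) (a p : R) (n s : nat) :
  0 < a -> expR 1 <= n%:R :> R ->
  0 <= p -> p <= 2 `^ (- a * Num.sqrt (n%:R : R) * log2 (n%:R : R)) ->
  s%:R <= a / 8 * Num.sqrt (n%:R : R) ->
  p * (n.+1 ^ (2 * s))%:R <= 2 / (a * Num.sqrt n%:R).
Proof.
move=> a0 le_en p0 le_p le_s.
have n0 : 0 < n%:R :> R by apply: lt_le_trans le_en; apply: expR_gt0.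
have n2 : (2 <= n)%N.
  by rewrite -(ler_nat R); apply: le_trans le_en; have := expR_ge1Dx (1 : R); lra.
set x : R := Num.sqrt n%:R in le_p le_s *.
have x0 : 0 < x by rewrite sqrtr_gt0.
set l : R := ln n%:R.
have l1 : 1 <= l by rewrite -[leLHS](expRK 1) ler_ln ?posrE ?expR_gt0.
have ln2 : 0 < ln 2 :> R by rewrite ln_gt0 // ltr1n.
have {}le_p : p <= expR (- a * x * l).
  apply: le_trans le_p _; rewrite /powR gt_eqF // /log2 -/l.
  by rewrite le_eqVlt; apply/orP; left; apply/eqP; congr expR; field; rewrite gt_eqF.
have le_pow : (n.+1 ^ (2 * s))%:R <= expR (a / 2 * x * l).
  apply: (@le_trans _ _ ((n ^ 2) ^ (2 * s))%:R).
    rewrite ler_nat; have [->|s0] := posnP (2 * s); first by rewrite !expn0.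
    by rewrite leq_exp2r //; clear -n2; nia.
  rewrite -expnM natrX -[n%:R]lnK ?posrE // -expRM_natl ler_expR -/l natrM natrM.
  rewrite ler_wpM2r //; lra.
apply: (@le_trans _ _ (expR (- a * x * l) * expR (a / 2 * x * l))).
  by apply: ler_pM.
rewrite -expRD (_ : _ + _ = - (a / 2 * x * l)); last by field.
rewrite expRN -[leRHS]invrK lef_pV2 ?posrE ?expR_gt0 ?invr_gt0 ?divr_gt0 ?mulr_gt0 //.
rewrite invf_div; apply: le_trans (expR_ge1Dx _).
have : a / 2 * x * 1 <= a / 2 * x * l by rewrite ler_pM2l // !mulr_gt0.
lra.
Qed.

Theorem theorem6p2 (R : realType) (p : nat -> R) (t : nat -> nat)
    (p01 : forall n : nat, 0 <= p n <= 1)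
    (p_upper : exists2 a : R, 0 < a &
       \forall n \near \oo,
         p n <= 2 `^ (- a * Num.sqrt (n%:R : R) * log2 (n%:R : R)))
    (p_lower : exists2 w : nat -> R, w @ \oo --> +oo &
       \forall n \near \oo, w n / 2 ^+ n <= p n)
    (t_gt0 : forall n : nat, (0 < t n)%N)
    (t_small : (fun n : nat => (t n)%:R : R^o) =o_\oo
               (fun n : nat => Num.sqrt (n%:R : R) : R^o)) :
  exists2 eps : R, 0 < eps &
    random_family_prob (p n)
      (fun F : {set {set 'I_n}} =>
         (2^-1 + eps) * 2 ^+ n * p n <= (max_t_intersecting (t n) F)%:R)
      @[n --> \oo] --> (1 : R).
Proof.
case: p_upper => a a0 p_up; case: p_lower => w w_oo p_low.
(* Eventually [m <= 2x/K] and [t n <= x/K] with [x = sqrt n]; since [3/K < a/8], this meets the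
   bound that [sparse_conflicts_le] asks of [m + t n]. *)
pose K := (Num.truncn (24 / a)).+1; pose k : R := K%:R.
have kgt : 24 / a < k by apply: truncnS_gt.
have k1 : 1 <= k by rewrite ler1n.
have k0 : 0 < k by lra.
exists (16 * k)^-1 => [|]; first by rewrite invr_gt0 mulr_gt0.
set eps := (16 * k)^-1; have eps0 : 0 < eps by rewrite invr_gt0 mulr_gt0.
apply/cvgrPdist_le => e e0; near=> n.
have p_n : p n <= 2 `^ (- a * Num.sqrt (n%:R : R) * log2 (n%:R : R)) by near: n.
have w_n : w n / 2 ^+ n <= p n by near: n.
(* This threshold brings the Chebyshev error below [e / 2], and [x_big] does so for the conflict
   error; [x_6] serves for [2(t + m) <= 6x <= x^2 = n]. *)
have w_big : 2 / (eps ^+ 2 * e) <= w n.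
  by near: n; move: w_oo => /cvgryPge; apply.
have e_n : expR 1 <= n%:R :> R by near: n; exact: nbhs_infty_ger.
have x_k : k <= Num.sqrt (n%:R : R) by near: n; exact: near_sqrt_ge.
have x_6 : 6 <= Num.sqrt (n%:R : R) by near: n; exact: near_sqrt_ge.
have x_big : 4 / (a * eps * e) <= Num.sqrt (n%:R : R) by near: n; exact: near_sqrt_ge.
have t_n : (t n)%:R <= k^-1 * Num.sqrt (n%:R : R).
  suff : `|(t n)%:R : R^o| <= k^-1 * `|Num.sqrt (n%:R : R) : R^o|.
    by rewrite !ger0_norm ?sqrtr_ge0.
  near: n; move/eqoP : t_small; apply; rewrite invr_gt0 //.
set x : R := Num.sqrt n%:R in p_n x_k x_6 x_big t_n.
have xx : x ^+ 2 = n%:R by rewrite sqr_sqrtr.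
(* Rounding up past [r / K] ensures [K * m >= r + 1 > sqrt n], as the central window estimate
   needs. *)
pose r := Num.truncn x; pose m := (r %/ K).+1.
have r_x : r%:R <= x by rewrite truncn_le; lra.
have x_r : x < r.+1%:R by apply: truncnS_gt.
have n_Km : (n < (K * m) ^ 2)%N.
  have : (r.+1 <= K * m)%N by rewrite mulnC ltn_ceil.
  have : (n < r.+1 ^ 2)%N.
    by rewrite -(ltr_nat R) natrX -xx ltr_pXn2r ?nnegrE //; lra.
  by move=> lt1 le2; apply: leq_trans lt1 _; rewrite leq_exp2r.
have m_x : m%:R <= k^-1 * x + 1.
  rewrite /m -natr1 lerD2r mulrC ler_pdivlMr //.
  by apply: le_trans r_x; rewrite -natrM ler_nat leq_trunc_div.
have k_x : 1 <= k^-1 * x by rewrite mulrC ler_pdivlMr // mul1r.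
have kinv1 : k^-1 * x <= x by rewrite ler_piMl ?invf_le1 //; lra.
have tm_n : ((t n + m).*2 <= n)%N.
  rewrite -(ler_nat R) -mul2n natrM natrD -xx.
  have : 6 * x <= x ^+ 2 by rewrite expr2 ler_wpM2r //; lra.
  by lra.
have pow0 : 0 < 2 ^+ n :> R by rewrite exprn_gt0.
(* Strict positivity comes from the lower bound [w n / 2 ^+ n], where [w n] is already positive. *)
have p0 : 0 < p n.
  apply: lt_le_trans w_n; rewrite divr_gt0 //; apply: lt_le_trans w_big.
  by rewrite divr_gt0 // mulr_gt0 // exprn_gt0.
have [_ p1] := andP (p01 n).
have k_a : k^-1 < a / 24 by rewrite -[ltRHS]invf_div ltf_pV2 ?posrE ?divr_gt0.
have s_x : (m + t n)%:R <= a / 8 * x.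
  have : k^-1 * x <= a / 24 * x by rewrite ler_wpM2r ?ltW //; lra.
  by rewrite natrD; lra.
have := @random_family_prob_ge R n m (t n) K (p n) eps erefl.
rewrite p0 p1 => /(_ isT isT tm_n n_Km).
have := @sparse_conflicts_le R a (p n) n (m + t n) a0 e_n (ltW p0) p_n s_x.
rewrite -/x; set P := random_family_prob _ _; set c := _%:R => le_c ge_P.
have P1 : P <= 1 by apply: random_family_prob_le1.
have b1 : (eps ^+ 2 * (2 ^+ n * p n))^-1 <= e / 2.
  have pos1 : 0 < 2 / e by apply: divr_gt0.
  have pos2 : 0 < eps ^+ 2 * (2 ^+ n * p n) by rewrite !mulr_gt0 ?exprn_gt0.
  rewrite -[leRHS]invf_div lef_pV2 ?posrE //.
  rewrite [leRHS]mulrC -ler_pdivrMr ?exprn_gt0 //.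
  apply: (@le_trans _ _ (w n)); last by rewrite [leRHS]mulrC -ler_pdivrMr.
  by apply: le_trans w_big; rewrite -mulrA -invfM mulrC [_ * e]mulrC mulrC.
have b2 : p n * c / eps <= e / 2.
  rewrite ler_pdivrMr //; apply: le_trans le_c _.
  rewrite ler_pdivrMr ?mulr_gt0 //; last lra.
  move: x_big; rewrite ler_pdivrMr ?mulr_gt0 //.
  have -> : e / 2 * eps * (a * x) = x * (a * eps * e) / 2 by field.
  by lra.
by rewrite ger0_norm; lra.
Unshelve. all: by end_near. Qed.
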